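(* Let $n\geq 2$ be an integer and let $\mathbf{M}\sim\mathcal{U}(\mathcal{M}_n)$. Then for every $1\leq i,j\leq n$, $\mathbf{M}_{i,j}\sim\mathrm{Beta}(1,n-1)$, and for every $1\leq i,i',j,j'\leq n$, $$\mathrm{Cov}(\mathbf{M}_{i,j},\mathbf{M}_{i',j'})=\begin{cases}0 & \text{if } i\neq i',\\ \frac{n-1}{n^2(n+1)} & \text{if } i=i' \text{ and } j=j',\\ -\frac{1}{n^2(n+1)} & \text{if } i=i' \text{ and } j\neq j'.\end{cases}$$ Moreover, $\mathbf{M}_{i,j}$ and $\mathbf{M}_{i',j'}$ are independent if and only if $i\neq i'$.
   Context: A real $n\times n$ matrix is Markov if its entries are non-negative and each row sums to $1$. $\mathcal{M}_n$ denotes the set of all $n\times n$ Markov matrices; it is a compact convex polytope in $\mathbb{R}^{n^2}$ of dimension $n(n-1)$. The uniform distribution $\mathcal{U}(\mathcal{M}_n)$ on $\mathcal{M}_n$ is the normalized trace on $\mathcal{M}_n$ of the Lebesgue measure of $\mathbb{R}^{n^2}$, i.e. the probability measure obtained by normalizing the restriction to $\mathcal{M}_n$ of the $n(n-1)$-dimensional Hausdorff measure (equivalently, the Lebesgue measure of the affine hull of $\mathcal{M}_n$). $\mathrm{Beta}(\alpha,\beta)$ is the distribution on $[0,1]$ with Lebesgue density $t\mapsto\frac{\Gamma(\alpha+\beta)}{\Gamma(\alpha)\Gamma(\beta)}t^{\alpha-1}(1-t)^{\beta-1}$. *)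

(* Defs.v *)
From HB Require Import structures.
From mathcomp Require Import all_boot all_order all_algebra.
From mathcomp Require Import all_classical all_reals all_analysis.
From mathcomp Require Import measurable_realfun.

Set Implicit Arguments.
Unset Strict Implicit.
Unset Printing Implicit Defensive.

Import Order.TTheory GRing.Theory Num.Theory.
Import numFieldNormedType.Exports.

Local Open Scope classical_set_scope.
Local Open Scope ring_scope.

Section hausdorff.
Context (R : realType) (T : Type) (dist : T -> T -> R) (s : nat).
Implicit Types (A : set T) (delta : R).
Local Open Scope ereal_scope.

Definition diam A : \bar R := ereal_sup [set (dist x y)%:E | x in A & y in A].

(* The empty set is treated apart: its supremum above is -oo, and it must
   weigh nothing even in dimension s = 0. *)
Definition diam_weight A : \bar R := if A == set0 then 0 else diam A ^+ s.

Definition hausdorff_pre delta A : \bar R :=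
  ereal_inf [set \sum_(0 <= k <oo) diam_weight (F k) |
             F in [set F : (set T)^nat | A `<=` \bigcup_k F k /\
                                         forall k, diam (F k) <= delta%:E]].

(* The s-dimensional Hausdorff measure, up to the constant factor that would
   make it agree with the Lebesgue measure on R^s; that factor cancels in
   normalized measures. *)
Definition hausdorff A : \bar R :=
  ereal_sup [set hausdorff_pre delta A | delta in [set delta | (0 < delta)%R]].

End hausdorff.

Section markov.
Context (R : realType) (n : nat).

(* The matrix norm of the library is the sup norm; R^(n^2) is Euclidean. *)
Definition mx_dist (A B : 'M[R]_n) : R :=
  Num.sqrt (\sum_i \sum_j (A i j - B i j) ^+ 2).

Definition markov_mx : set 'M[R]_n :=
  [set A : 'M[R]_n | (forall i j, 0 <= A i j) /\ (forall i, \sum_j A i j = 1)].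

Definition mx_borel := g_sigma_algebraType (@open 'M[R]_n).

(* markov_mx is a convex body of an affine subspace of dimension n * n.-1, hence its
   Hausdorff measure in that dimension is positive and finite, and fine is
   the identity on it. *)
Definition uniform_markov (A : set mx_borel) : \bar R :=
  let H := hausdorff mx_dist (n * n.-1)%N in
  ((fine (H markov_mx))^-1%:E * H (A `&` markov_mx))%E.

Definition mx_coord (i j : 'I_n) (A : mx_borel) : R := (A : 'M[R]_n) i j.

Lemma measurable_mx_coord i j : measurable_fun [set: mx_borel] (mx_coord i j).
Proof.
apply: (measurability _ (RGenOpens.measurableE R)) => _ [_ [a [b ->] <-]].
rewrite setTI; apply: sub_sigma_algebra.
apply: open_comp; last exact: interval_open.
by move=> A _; exact: coord_continuous.
Qed.

HB.instance Definition _ i j :=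
  isMeasurableFun.Build _ _ _ _ (mx_coord i j) (measurable_mx_coord i j).

End markov.

Section random_variables.
Context d (Omega : measurableType d) (R : realType) (P : probability Omega R).

Definition entry n (M : {RV P >-> mx_borel R n}) (i j : 'I_n) : {RV P >-> R} :=
  mx_coord i j \o M.

Definition independent_RV (X Y : {RV P >-> R}) : Prop :=
  forall A B : set R, measurable A -> measurable B ->
    P (X @^-1` A `&` Y @^-1` B) = (P (X @^-1` A) * P (Y @^-1` B))%E.

End random_variables.

(* Main.v *)
Require Import Defs.
From mathcomp Require Import all_boot all_order all_algebra.
From mathcomp Require Import fingroup perm.
From mathcomp Require Import all_classical all_reals all_analysis.
From mathcomp Require Import unstable measurable_realfun ring lra.

(* Being a probability, the uniform law forces the Hausdorff measure of the
   Markov polytope to be positive and finite; apart from that, only the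
   invariance of Hausdorff measure under isometries is needed.
   Fix a row i, a column j and an event C about the other rows. The entries of
   row i outside column j range over a corner simplex, cut into cubes of side
   1/N. The cubes contained in the simplex are translates of one another, hence
   carry the same mass, also when intersected with C; counting them and letting
   N go to infinity gives P(M_ij >= t, C) = (1 - t)^(n-1) P(C). This contains
   both the Beta(1, n-1) law (C the sure event) and the independence of entries
   in different rows. For the covariances, permuting the entries of a row is an
   isometry of the polytope and the rows sum to 1, so all mixed second moments
   follow from the mean 1/n and the second moment of Beta(1, n-1). *)

Set Implicit Arguments.
Unset Strict Implicit.
Unset Printing Implicit Defensive.

Import Order.TTheory GRing.Theory Num.Theory.
Import numFieldNormedType.Exports.

Local Open Scope classical_set_scope.
Local Open Scope ring_scope.

(** * Isometry invariance of the Hausdorff measure *)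

Section hausdorff_isometry.
Context (R : realType) (T : Type) (dist : T -> T -> R) (s : nat).
Variable f : T -> T.
Hypothesis fdist : forall x y, dist (f x) (f y) = dist x y.
Local Open Scope ereal_scope.

Lemma diam_image A : diam dist (f @` A) = diam dist A.
Proof.
rewrite /diam; congr ereal_sup; apply/seteqP; split => z /=.
  by move=> [_ [x Ax <-]] [_ [y Ay <-]] <-; rewrite fdist; exists x => //; exists y.
move=> [x Ax] [y Ay] <-; exists (f x); first by exists x.
by exists (f y); [exists y|rewrite fdist].
Qed.

Lemma hausdorff_pre_image_le delta A :
  hausdorff_pre dist s delta (f @` A) <= hausdorff_pre dist s delta A.
Proof.
apply: ereal_inf_le_tmp => _ [F [AF Fd] <-].
exists (fun k => f @` F k).
  split; last by move=> k; rewrite diam_image.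
  by move=> _ [x /AF [k _ Fkx] <-]; exists k => //; exists x.
apply: eq_eseriesr => k _; rewrite /diam_weight diam_image.
suff -> : (f @` F k == set0) = (F k == set0) by [].
by apply/eqP/eqP => [/eqP|->]; [|exact: image_set0]; apply: contraTeq => /set0P[x Fx];
  apply/set0P; exists (f x), x.
Qed.

Lemma hausdorff_image_le A : hausdorff dist s (f @` A) <= hausdorff dist s A.
Proof.
apply: ge_ereal_sup => _ [delta d0 <-].
apply: le_trans (hausdorff_pre_image_le delta A) _.
by apply: ereal_sup_ubound; exists delta.
Qed.

End hausdorff_isometry.

(** The inverse [g] is an isometry as well, so the inequality for images holds in both
    directions. *)
Lemma hausdorff_image (R : realType) (T : Type) (dist : T -> T -> R) (s : nat)
    (f g : T -> T) (A : set T) :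
  (forall x y, dist (f x) (f y) = dist x y) -> cancel f g -> cancel g f ->
  hausdorff dist s (f @` A) = hausdorff dist s A.
Proof.
move=> fdist fK gK; apply/eqP; rewrite eq_le hausdorff_image_le//=.
have gdist x y : dist (g x) (g y) = dist x y by rewrite -fdist !gK.
have E : g @` (f @` A) = A.
  by apply/seteqP; split => [_ [_ [x Ax <-] <-]|x Ax];
    [rewrite fK|exists (f x); [exists x|rewrite fK]].
by rewrite -{1}E hausdorff_image_le.
Qed.

(** * Translations and row permutations as isometries *)

Section markov_symmetries.
Context (R : realType) (n : nat).
Implicit Types (M V : 'M[R]_n) (s : 'I_n -> 'S_n).

Lemma mx_dist_translate V M N : mx_dist (M + V) (N + V) = mx_dist M N.
Proof.
congr Num.sqrt; apply: eq_bigr => i _; apply: eq_bigr => j _.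
by rewrite !mxE opprD addrACA subrr addr0.
Qed.

(** Each row has its own permutation, so that a single row can be permuted while the others stay
    fixed. *)
Definition permute_rows s M : 'M[R]_n := \matrix_(i, j) M i (s i j).

Lemma permute_rowsK s : cancel (permute_rows s) (permute_rows (fun i => (s i)^-1%g)).
Proof. by move=> M; apply/matrixP => i j; rewrite !mxE permKV. Qed.

Lemma permute_rowsVK s : cancel (permute_rows (fun i => (s i)^-1%g)) (permute_rows s).
Proof. by move=> M; apply/matrixP => i j; rewrite !mxE permK. Qed.

Lemma mx_dist_permute_rows s M N :
  mx_dist (permute_rows s M) (permute_rows s N) = mx_dist M N.
Proof.
congr Num.sqrt; apply: eq_bigr => i _; rewrite [RHS](reindex_inj (@perm_inj _ (s i))).
by apply: eq_bigr => j _; rewrite !mxE.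
Qed.

Lemma markov_permute_rows s M : markov_mx (permute_rows s M) <-> markov_mx M.
Proof.
suff imp t N : markov_mx N -> markov_mx (permute_rows t N).
  by split => [/(imp (fun i => (s i)^-1%g))|]; [rewrite permute_rowsK|exact: imp].
move=> [N0 N1]; split => [i j|i]; first by rewrite mxE.
under eq_bigr do rewrite mxE.
by rewrite -(N1 i) [RHS](reindex_inj (@perm_inj _ (t i))).
Qed.

Lemma measurable_permute_rows s :
  measurable_fun [set: mx_borel R n] (permute_rows s : mx_borel R n -> mx_borel R n).
Proof.
apply: (@measurability _ _ (mx_borel R n) (mx_borel R n) setT _ (@open 'M[R]_n) erefl).
move=> _ [B oB <-].
rewrite setTI; apply: sub_sigma_algebra.
apply: open_comp => // M _ C [Q nQ QC].
(* Basic neighbourhoods of a matrix are boxes with one factor per entry; the preimage of a box is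
   the box with permuted factors. *)
exists (fun i j => Q i ((s i)^-1%g j)) => [i j|N NQ].
  by have := nQ i ((s i)^-1%g j); rewrite mxE permKV.
by apply: QC => i j; have := NQ i (s i j); rewrite mxE permK.
Qed.
End markov_symmetries.

(** * The uniform law on Markov matrices *)

Lemma measure_fin_bigcup_cst d (T : measurableType d) (R : realType)
    (mu : {finite_measure set T -> \bar R}) (I : finType) (S : {set I})
    (F : I -> set T) (c : R) :
  (forall t, t \in S -> measurable (F t)) -> trivIset [set` S] F ->
  (forall t, t \in S -> mu (F t) = c%:E) ->
  mu (\bigcup_(t in [set` S]) F t) = (#|S|%:R * c)%:E.
Proof.
move=> mF tF Fc; rewrite measure_fin_bigcup//.
rewrite (fsbigE (enum S)) ?enum_uniq//=; last 2 first.
- by move=> t; rewrite /= mem_enum.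
- by move=> t tS; rewrite mem_enum tS.
rewrite (eq_bigr (fun=> c%:E)) => [|t /set_mem/= tS]; last exact: Fc.
rewrite sumEFin big_enum_cond/= (eq_bigl (mem S)) => [|t]; last by rewrite mem_setE andbb.
by rewrite sumr_const mulr_natl.
Qed.

Section uniform.
Context (R : realType) (n : nat) (mu : probability (mx_borel R n) R).
Hypothesis mu_uniform : forall A : set (mx_borel R n), measurable A ->
  mu A = uniform_markov A.

Lemma measurable_entry_set (i j : 'I_n) (B : set R) : measurable B ->
  measurable [set M : mx_borel R n | B ((M : 'M[R]_n) i j)].
Proof. exact: (@measurable_funPTI _ _ _ _ (mx_coord i j)). Qed.

Lemma measurable_markov : measurable (@markov_mx R n : set (mx_borel R n)).
Proof.
have -> : (@markov_mx R n : set (mx_borel R n)) =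
  (\bigcap_(i in [set: 'I_n]) \bigcap_(j in [set: 'I_n])
     [set M : mx_borel R n | `[0, +oo[%classic ((M : 'M[R]_n) i j)]) `&`
  \bigcap_(i in [set: 'I_n])
     (fun M : mx_borel R n => \sum_j mx_coord i j M) @^-1` [set 1].
  apply/seteqP; split => M /=.
    move=> [M0 M1]; split; last by move=> i _; exact: M1.
    by move=> i _ j _; rewrite /= in_itv/= M0.
  move=> [M0 M1]; split=> [i j|i]; last exact: M1.
  by have := M0 i I j I; rewrite /= in_itv/= andbT.
apply: measurableI; apply: fin_bigcap_measurable => // i _.
  by apply: fin_bigcap_measurable => // j _; exact: measurable_entry_set.
rewrite -[X in measurable X]setTI; apply: measurable_sum => //.
Qed.

(** [uniform_markov] intersects its argument with the polytope, so it takes the same value on the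
    polytope as on the whole space, which has mass 1. *)
Lemma mu_markov : mu (@markov_mx R n) = 1%E.
Proof.
rewrite (mu_uniform measurable_markov).
have := mu_uniform measurableT; rewrite probability_setT.
by rewrite /uniform_markov setTI setIid.
Qed.

Lemma mu_setI_markov (A : set (mx_borel R n)) : measurable A ->
  mu (A `&` @markov_mx R n) = mu A.
Proof.
move=> mA; rewrite !mu_uniform//; last by apply: measurableI => //; exact: measurable_markov.
by rewrite /uniform_markov -setIA setIid.
Qed.

(** Translation by [V] need not preserve the polytope. Both sets are assumed to lie in it, so that
    the law compares their plain Hausdorff measures. *)
Lemma mu_translate (V : 'M[R]_n) (A B : set (mx_borel R n)) :
  measurable A -> measurable B -> A `<=` @markov_mx R n -> B `<=` @markov_mx R n ->
  B = (fun M : 'M[R]_n => M + V) @` A -> mu B = mu A.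
Proof.
move=> mA mB AM BM BA; rewrite !mu_uniform// /uniform_markov !setIidl//; congr (_ * _)%E.
rewrite BA; apply: (@hausdorff_image _ _ _ _ _ (fun M => M - V)) => [M N|M|M].
- exact: mx_dist_translate.
- by rewrite addrK.
- by rewrite subrK.
Qed.

Lemma mu_permute_rows (s : 'I_n -> {perm 'I_n}) (A : set (mx_borel R n)) :
  measurable A -> mu ((permute_rows s : _ -> mx_borel R n) @^-1` A) = mu A.
Proof.
move=> mA; rewrite !mu_uniform//; last first.
  by rewrite -[X in measurable X]setTI; exact: measurable_permute_rows.
rewrite /uniform_markov; congr (_ * _)%E.
(* The preimage is rewritten as an image under the inverse permutations, which preserve the
   polytope. *)
have -> : (permute_rows s : _ -> mx_borel R n) @^-1` A `&` @markov_mx R n =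
    permute_rows (fun i => (s i)^-1%g) @` (A `&` @markov_mx R n).
  apply/seteqP; split => [M [AM mM]|_ [M [AM mM] <-]] /=.
    exists (permute_rows s M); last by rewrite permute_rowsK.
    by split => //; apply/markov_permute_rows.
  by split; [rewrite /= permute_rowsVK|apply/markov_permute_rows].
apply: hausdorff_image (permute_rowsVK s) (permute_rowsK s).
by move=> M N; exact: mx_dist_permute_rows.
Qed.

End uniform.

(** * Cubes in a row of a Markov matrix *)

Section cells.
Context (R : realType) (n : nat) (mu : probability (mx_borel R n) R).
Hypothesis mu_uniform : forall A : set (mx_borel R n), measurable A ->
  mu A = uniform_markov A.
Variables (i j : 'I_n) (C : set (mx_borel R n)).
Hypothesis mC : measurable C.
Hypothesis C_row : forall M M' : 'M[R]_n,
  (forall a b, a != i -> M a b = M' a b) -> C M -> C M'.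

Lemma markov_entryE (M : 'M[R]_n) : markov_mx M ->
  M i j = 1 - \sum_(u < n.-1) M i (lift j u).
Proof. by move=> [_ /(_ i)]; rewrite (bigD1_ord j)//= => <-; rewrite addrK. Qed.

(** As row [i] sums to 1, the last condition says that its entries outside column [j] lie in the
    corner simplex of size [r]. *)
Definition row_slab (r : R) : set (mx_borel R n) :=
  [set M : 'M[R]_n | [/\ markov_mx M, C M & 1 - r <= M i j]].

(** A cube of side 1/N with corner k/N in the entries of row [i] outside column [j]. It is
    half-open, so that different [k] give disjoint cells. *)
Definition row_cell (N : nat) (k : 'I_n.-1 -> nat) : set (mx_borel R n) :=
  [set M : 'M[R]_n | [/\ markov_mx M, C M &
    forall u, (k u)%:R <= N%:R * M i (lift j u) < (k u).+1%:R]].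

Lemma measurable_row_slab r : measurable (row_slab r).
Proof.
have -> : row_slab r = @markov_mx R n `&` C `&`
    [set M : mx_borel R n | `[1 - r, +oo[%classic ((M : 'M[R]_n) i j)].
  apply/seteqP; split => M /=; rewrite in_itv/= andbT; first by case.
  by move=> [[]].
apply: measurableI; last exact: measurable_entry_set.
by apply: measurableI => //; exact: measurable_markov.
Qed.

Lemma measurable_row_cell N k : measurable (row_cell N k).
Proof.
have -> : row_cell N k = @markov_mx R n `&` C `&` \bigcap_(u in [set: 'I_n.-1])
    [set M : mx_borel R n | [set x | (k u)%:R <= N%:R * x < (k u).+1%:R]
      ((M : 'M[R]_n) i (lift j u))].
  apply/seteqP; split => M /= => [[? ? H]|[[? ?] H]]; first by split=> // u _; exact: H.
  by split=> // u; exact: H.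
apply: measurableI; first by apply: measurableI => //; exact: measurable_markov.
apply: fin_bigcap_measurable => // u _; apply: measurable_entry_set.
have -> : [set x : R | (k u)%:R <= N%:R * x < (k u).+1%:R] =
    ( *%R N%:R) @^-1` `[(k u)%:R, (k u).+1%:R[%classic.
  by apply/seteqP; split => x /=; rewrite in_itv.
rewrite -[X in measurable X]setTI; exact: measurable_funM.
Qed.

(** Column [j] compensates for the other columns, so that adding this matrix preserves row sums. *)
Definition cell_shift (N : nat) (k : 'I_n.-1 -> nat) : 'M[R]_n :=
  \matrix_(a, b) if a == i then
    if unlift j b is Some u then (k u)%:R / N%:R else - \sum_u (k u)%:R / N%:R
  else 0.

Lemma cell_shift_row N k a : \sum_b cell_shift N k a b = 0.
Proof.
have [->|ai] := eqVneq a i; last by rewrite big1// => b _; rewrite mxE (negbTE ai).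
rewrite (bigD1_ord j)//= mxE eqxx unlift_none.
by under eq_bigr do rewrite mxE eqxx liftK; rewrite addNr.
Qed.

(** The bound on [k] says that the far corner (k + 1)/N of the cube is still in the simplex, so the
    shifted entry in column [j] stays non-negative. Only row [i] moves, hence [C] is preserved. *)
Lemma row_cell_shift N k : (0 < N)%N -> (\sum_u k u + n.-1 <= N)%N ->
  row_cell N k = (fun M : 'M[R]_n => M + cell_shift N k) @` row_cell N (fun=> 0%N).
Proof.
move=> N0 kN; have Nr0 : 0 < N%:R :> R by rewrite ltr0n.
have NV u : N%:R * cell_shift N k i (lift j u) = (k u)%:R.
  by rewrite mxE eqxx liftK mulrC divfK// gt_eqF.
have NVj : N%:R * cell_shift N k i j = - (\sum_u k u)%N%:R.
  by rewrite mxE eqxx unlift_none mulrN -mulr_suml mulrC divfK ?gt_eqF// natr_sum.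
have Va a b : a != i -> cell_shift N k a b = 0 by move=> ai; rewrite mxE (negbTE ai).
apply/seteqP; split => [M [mM CM Mk]|_ [M [mM CM Mk] <-]].
  exists (M - cell_shift N k); last by rewrite subrK.
  split.
  - split => [a b|a]; last first.
      under eq_bigr do rewrite mxE [X in _ + X]mxE.
      by rewrite sumrB cell_shift_row subr0; case: mM.
    have M0 := mM.1; rewrite mxE [X in _ + X]mxE.
    have [->|ai] := eqVneq a i; last by rewrite Va// subr0.
    rewrite -(pmulr_rge0 _ Nr0) mulrBr; case: (unliftP j b) => [u|] ->.
      by rewrite NV subr_ge0; case/andP: (Mk u).
    by rewrite NVj opprK addr_ge0// mulr_ge0// ltW.
  - apply: C_row CM => a b ai; rewrite mxE [X in _ + X]mxE Va// subr0//.
  - move=> u; rewrite mxE [X in _ + X]mxE mulrBr NV.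
    by move: (Mk u); rewrite -natr1; lra.
have M0 := mM.1; split.
- split => [a b|a]; last first.
    under eq_bigr do rewrite mxE.
    by rewrite big_split/= cell_shift_row addr0; case: mM.
  rewrite mxE; have [->|ai] := eqVneq a i; last by rewrite Va// addr0.
  rewrite -(pmulr_rge0 _ Nr0) mulrDr; case: (unliftP j b) => [u|] ->.
    by rewrite NV addr_ge0// mulr_ge0// ltW.
  (* In the cell at the origin each of the [n.-1] scaled free entries is below 1, so together with
     the shift they add up to at most N. *)
  rewrite NVj subr_ge0 (markov_entryE mM) mulrBr mulr1 lerBrDr.
  apply: le_trans (_ : (\sum_u k u + n.-1)%N%:R <= _); last by rewrite ler_nat.
  rewrite natrD lerD2l mulr_sumr.
  rewrite (_ : n.-1%:R = \sum_(u < n.-1) 1); last by rewrite sumr_const card_ord.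
  by apply: ler_sum => u _; case/andP: (Mk u) => _ /ltW.
- by apply: C_row CM => a b ai; rewrite mxE Va// addr0.
- move=> u; rewrite mxE mulrDr NV.
  by move: (Mk u); rewrite -natr1; lra.
Qed.

Lemma mu_row_cell N k : (0 < N)%N -> (\sum_u k u + n.-1 <= N)%N ->
  mu (row_cell N k) = mu (row_cell N (fun=> 0%N)).
Proof.
move=> N0 kN.
apply: (mu_translate mu_uniform _ _ _ _ (row_cell_shift N0 kN)).
- exact: measurable_row_cell.
- exact: measurable_row_cell.
- by move=> M [].
- by move=> M [].
Qed.

Lemma row_cell_inj N (k k' : 'I_n.-1 -> nat) (M : 'M[R]_n) :
  row_cell N k M -> row_cell N k' M -> k =1 k'.
Proof.
have le_cell (x : R) (a b : nat) : a%:R <= x < a.+1%:R -> b%:R <= x < b.+1%:R -> (a <= b)%N.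
  by move=> /andP[ax _] /andP[_ xb]; have := le_lt_trans ax xb; rewrite ltr_nat.
move=> [_ _ H] [_ _ H'] u; apply/eqP; rewrite eqn_leq.
by rewrite (le_cell _ _ _ (H u) (H' u)) (le_cell _ _ _ (H' u) (H u)).
Qed.

(** Indices of sum at most [q] have all components at most [q]; tuples over ['I_q.+1] therefore lose
    none of them and form a finite type. *)
Definition tuple_cells (N q : nat) : set (mx_borel R n) :=
  \bigcup_(t in [set` [set t : n.-1.-tuple 'I_q.+1 | (\sum_(x <- t) x <= q)%N]%SET])
    row_cell N (fun u => tnth t u).

Lemma tuple_sumE q (t : n.-1.-tuple 'I_q.+1) :
  (\sum_(x <- t) x = \sum_u tnth t u)%N.
Proof. by rewrite big_tuple. Qed.

(** The cells are disjoint translates of the one at the origin, and the binomial coefficient counts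
    their indices by stars and bars. *)
Lemma mu_tuple_cells N q : (0 < N)%N -> (q + n.-1 <= N)%N ->
  mu (tuple_cells N q) =
  ('C(n.-1 + q, n.-1)%:R * fine (mu (row_cell N (fun=> 0%N))))%:E.
Proof.
move=> N0 qN; rewrite -card_partial_ord_partitions.
apply: measure_fin_bigcup_cst => [t _||t].
- exact: measurable_row_cell.
- move=> s t _ _ [M [Ms Mt]]; apply: eq_from_tnth => u.
  by apply: val_inj; exact: row_cell_inj Ms Mt u.
- rewrite inE => tq; rewrite fineK ?fin_num_measure//; last exact: measurable_row_cell.
  by apply: mu_row_cell => //; rewrite -tuple_sumE (leq_trans _ qN)// leq_add2r.
Qed.

End cells.

(** Together with [ffact_geq_exp], this compares quotients of binomial coefficients with powers of a
    ratio. *)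
Lemma ffact_leq_exp p m : (p ^_ m <= p ^ m)%N.
Proof.
elim: m p => [//|m IH] p; rewrite ffactnS expnS leq_mul2l; apply/orP; right.
apply: leq_trans (IH _) _; case: m {IH} => [//|m].
by rewrite leq_exp2r// leq_pred.
Qed.

Lemma ffact_geq_exp p m : ((p - m) ^ m <= p ^_ m)%N.
Proof.
elim: m p => [//|m IH] p; rewrite ffactnS expnS leq_mul ?leq_subr//.
by apply: leq_trans (IH _); rewrite -subn1 -subnDA add1n.
Qed.

(** * Matrices with a vanishing entry form a null set *)

Section zero_entry.
Context (R : realType) (n : nat) (mu : probability (mx_borel R n) R).
Hypothesis mu_uniform : forall A : set (mx_borel R n), measurable A ->
  mu A = uniform_markov A.
Variables (i j : 'I_n).

(** Moving mass [e] from column [l] to column [j] carries [facet l 0] onto [facet l e]. The lower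
    bound on the entry in column [l] keeps it non-negative as long as [e] is at most 1/n. *)
Let facet (l : 'I_n) (e : R) : set (mx_borel R n) :=
  [set M : 'M[R]_n | [/\ markov_mx M, M i j = e & n%:R^-1 - e <= M i l]].

Let measurable_facet l e : measurable (facet l e).
Proof.
have -> : facet l e = @markov_mx R n `&`
    [set M : mx_borel R n | [set e] ((M : 'M[R]_n) i j)] `&`
    [set M : mx_borel R n | `[n%:R^-1 - e, +oo[%classic ((M : 'M[R]_n) i l)].
  apply/seteqP; split => M /=; rewrite in_itv/= andbT; first by case.
  by move=> [[]].
apply: measurableI; last exact: measurable_entry_set.
by apply: measurableI; [exact: measurable_markov|exact: measurable_entry_set].
Qed.

Let mu_facet l e : l != j -> 0 <= e <= n%:R^-1 -> mu (facet l e) = mu (facet l 0).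
Proof.
move=> lj /andP[e0 en].
pose V : 'M[R]_n := \matrix_(a, b)
  if a == i then (if b == j then e else if b == l then - e else 0) else 0.
have MD (A B : 'M[R]_n) a b : (A + B) a b = A a b + B a b by rewrite mxE.
have MB (A B : 'M[R]_n) a b : (A - B) a b = A a b - B a b by rewrite !mxE.
have Va a : \sum_b V a b = 0.
  have [->|ai] := eqVneq a i; last by rewrite big1// => b _; rewrite mxE (negbTE ai).
  rewrite (bigD1 j)//= (bigD1 l)//= big1 => [|b /andP[bj bl]].
    by rewrite !mxE !eqxx (negbTE lj) addr0 subrr.
  by rewrite mxE eqxx (negbTE bj) (negbTE bl).
apply: (mu_translate mu_uniform (V := V)) => //; try by move=> M [].
apply/seteqP; split => [M [mM Mj Ml]|_ [M [mM Mj Ml] <-]].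
  exists (M - V); last by rewrite subrK.
  split.
  - split=> [a b|a]; last first.
      under eq_bigr do rewrite MB.
      by rewrite sumrB Va subr0; case: mM.
    rewrite MB mxE; have := mM.1 a b.
    have [->|_] := eqVneq a i; last by rewrite subr0.
    have [->|_] := eqVneq b j; first by rewrite Mj subrr.
    have [->|_] := eqVneq b l; first by lra.
    by rewrite subr0.
  - by rewrite MB mxE !eqxx Mj subrr.
  - by rewrite MB mxE !eqxx (negbTE lj); lra.
split.
- split=> [a b|a]; last first.
    under eq_bigr do rewrite MD.
    by rewrite big_split/= Va addr0; case: mM.
  rewrite MD mxE; have := mM.1 a b.
  have [->|_] := eqVneq a i; last by rewrite addr0.
  have [->|_] := eqVneq b j; first by lra.
  have [->|_] := eqVneq b l; first by move=> _; lra.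
  by rewrite addr0.
- by rewrite MD mxE !eqxx Mj add0r.
- by rewrite MD mxE !eqxx (negbTE lj); lra.
Qed.

Let n_gt0 : 0 < n%:R :> R.
Proof. by rewrite ltr0n; case: (n) i => // -[]. Qed.

(* The polytope contains arbitrarily many disjoint translates of facet l 0. *)
Let mu_facet0 l : l != j -> mu (facet l 0) = 0%E.
Proof.
move=> lj; have fin_facet := fin_num_measure mu _ (measurable_facet l 0).
suff c0 : fine (mu (facet l 0)) <= 0.
  by apply/eqP; rewrite eq_le measure_ge0 -[leLHS]fineK// lee_fin c0.
rewrite leNgt; apply/negP => c_gt0; set c := fine _ in c_gt0.
(* With this many copies the total mass exceeds 1. The offsets [e q], multiples of 1/(nK), stay
   below 1/n, the range allowed by [mu_facet]. *)
pose K := (Num.truncn c^-1).+1.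
have Kc : 1 < K%:R * c by rewrite -ltr_pdivrMr// mul1r; exact: truncnS_gt.
pose e (q : 'I_K) : R := q%:R / (n%:R * K%:R).
have nK0 : 0 < n%:R * K%:R :> R by rewrite mulr_gt0.
suff : mu (\bigcup_(q in [set` [set: 'I_K]%SET]) facet l (e q)) = (K%:R * c)%:E.
  have /(probability_le1 mu) : measurable (\bigcup_(q in [set` [set: 'I_K]%SET]) facet l (e q)).
    by apply: fin_bigcup_measurable.
  by move=> + E; rewrite E lee_fin leNgt Kc.
rewrite -[in RHS](card_ord K) -cardsT; apply: measure_fin_bigcup_cst => // [p q _ _|q _].
  move=> [M [[_ + _] [_ + _]]] => -> /(mulIf (invr_neq0 (lt0r_neq0 nK0))) /eqP.
  by rewrite eqr_nat => /eqP /val_inj.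
apply: eq_trans (mu_facet lj _) _; last by rewrite fineK.
rewrite /e divr_ge0 ?(ltW nK0)//= invfM mulrCA.
by rewrite ler_piMr ?invr_ge0 ?(ltW n_gt0)// ler_pdivrMr ?mul1r ?ltr0n// ler_nat ltnW.
Qed.

Lemma mu_entry_eq0 : mu [set M : mx_borel R n | (M : 'M[R]_n) i j = 0] = 0%E.
Proof.
have mE := measurable_entry_set i j (measurable_set1 (0 : R)).
rewrite -(mu_setI_markov mu_uniform)//.
apply/eqP; rewrite eq_le measure_ge0 andbT.
(* If the entry in column [j] vanishes, some other entry of the row is at least 1/n: otherwise the
   row would sum to at most (n - 1)/n. *)
have cover : [set M : mx_borel R n | (M : 'M[R]_n) i j = 0] `&` @markov_mx R n `<=`
    \bigcup_(l in [set l | l != j]) facet l 0.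
  move=> M [/= Mj mM].
  suff [l lj Ml] : exists2 l, l != j & n%:R^-1 <= (M : 'M[R]_n) i l.
    by exists l => //; split=> //; rewrite subr0.
  apply: contrapT => H.
  suff : \sum_(l | l != j) (M : 'M[R]_n) i l <= n.-1%:R / n%:R.
    have := mM.2 i; rewrite (bigD1 j)//= Mj add0r => ->.
    rewrite ler_pdivlMr// mul1r ler_nat leqNgt prednK ?leqnn//.
    by rewrite -(ltr_nat R).
  have -> : n.-1%:R / n%:R = \sum_(l | l != j) n%:R^-1 :> R.
    by rewrite sumr_const cardC1 card_ord mulr_natl.
  apply: ler_sum => l lj; rewrite leNgt; apply/negP => Ml; apply: H.
  by exists l => //; exact: ltW.
have fin_ne : finite_set [set l | l != j] by exact: finite_finset.
apply: le_trans (content_sub_fsum mu fin_ne _ _ cover) _ => //.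
  by apply: measurableI => //; exact: measurable_markov.
by rewrite fsbig1// => l /=; exact: mu_facet0.
Qed.

End zero_entry.

(** * Tails of an entry *)

Section slab.
Context (R : realType) (n : nat) (mu : probability (mx_borel R n) R).
Hypothesis mu_uniform : forall A : set (mx_borel R n), measurable A ->
  mu A = uniform_markov A.
Variables (i j : 'I_n) (C : set (mx_borel R n)).
Hypothesis mC : measurable C.
Hypothesis C_row : forall M M' : 'M[R]_n,
  (forall a b, a != i -> M a b = M' a b) -> C M -> C M'.

Let m := n.-1.
Let cell N : R := fine (mu (row_cell i j C N (fun=> 0%N))).
Let slab r : R := fine (mu (row_slab i j C r)).

Let slab_ge0 r : 0 <= slab r.
Proof. by rewrite /slab fine_ge0// measure_ge0. Qed.

Let slabE r : mu (row_slab i j C r) = (slab r)%:E.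
Proof. by rewrite fineK// fin_num_measure//; exact: measurable_row_slab. Qed.

Let mx_entryE (M : 'M[R]_n) N : markov_mx M ->
  N%:R * M i j = N%:R - \sum_(u < m) N%:R * M i (lift j u).
Proof. by move=> mM; rewrite (markov_entryE i j mM) mulrBr mulr1 mulr_sumr. Qed.

Let measurable_tuple_cells N q : measurable (tuple_cells i j C N q).
Proof.
by apply: fin_bigcup_measurable => [|t _]; [exact: finite_finset|exact: measurable_row_cell].
Qed.

(** A cube of index sum at most p - m has a far corner of coordinate sum at most p/N, hence lies in
    the simplex of size [r]. *)
Lemma slab_lower N p r : (0 < N)%N -> (m <= p <= N)%N -> p%:R <= N%:R * r ->
  'C(p, m)%:R * cell N <= slab r.
Proof.
move=> N0 /andP[mp pN] pr; have Nr0 : 0 < N%:R :> R by rewrite ltr0n.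
have pmN : (p - m + m <= N)%N by rewrite subnK.
have := mu_tuple_cells mu_uniform j mC C_row N0 pmN.
rewrite addnC subnK// -/(cell N) -lee_fin -slabE => <-.
apply: le_measure; rewrite ?inE; [exact: measurable_tuple_cells|exact: measurable_row_slab|].
move=> M [t + [mM CM Mt]]; rewrite /= inE tuple_sumE => tp; split => //.
rewrite -(ler_pM2l Nr0) (mx_entryE _ mM) mulrBr mulr1 lerD2l lerN2.
apply: le_trans pr; apply: le_trans (_ : (\sum_u tnth t u + m)%N%:R <= _); last first.
  by rewrite ler_nat addnC -leq_subRL.
rewrite natrD natr_sum (_ : m%:R = \sum_(u < m) 1); last by rewrite sumr_const card_ord.
rewrite -big_split/=; apply: ler_sum => u _.
by case/andP: (Mt u) => _ /ltW; rewrite -natr1.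
Qed.

(** Truncating the scaled free entries puts each matrix of the slab in a cube of index sum at most
    [p]; as p + m is at most N, these cubes lie in the simplex of size 1 and have equal mass. *)
Lemma slab_upper N p r : (0 < N)%N -> (p + m <= N)%N -> N%:R * r < p.+1%:R ->
  slab r <= 'C(m + p, m)%:R * cell N.
Proof.
move=> N0 pN rp; have Nr0 : 0 < N%:R :> R by rewrite ltr0n.
have := mu_tuple_cells mu_uniform j mC C_row N0 pN.
rewrite -/(cell N) -lee_fin -slabE => <-.
apply: le_measure; rewrite ?inE; [exact: measurable_row_slab|exact: measurable_tuple_cells|].
move=> M [mM CM]; rewrite -(ler_pM2l Nr0) (mx_entryE _ mM) mulrBr mulr1 lerD2l lerN2 => Mr.
have M0 u : 0 <= N%:R * M i (lift j u) by rewrite mulr_ge0 ?(ltW Nr0)//; case: mM.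
pose k u := Num.truncn (N%:R * M i (lift j u)).
have kM u : (k u)%:R <= N%:R * M i (lift j u) < (k u).+1%:R by exact: truncn_itv.
have kp : (\sum_u k u <= p)%N.
  rewrite -ltnS -(ltr_nat R); apply: le_lt_trans rp; apply: le_trans Mr.
  by rewrite natr_sum; apply: ler_sum => u _; case/andP: (kM u).
have kup u : (k u <= p)%N by apply: leq_trans kp; rewrite (bigD1 u)//= leq_addr.
pose t := [tuple inord (k u) : 'I_p.+1 | u < m].
have tk u : tnth t u = k u :> nat by rewrite tnth_mktuple inordK// ltnS.
exists t; first by rewrite /= inE tuple_sumE; under eq_bigr do rewrite tk.
by split=> // u; rewrite tk.
Qed.

(** The upper bound for [r] is combined with the lower bound for 1, so that the unknown mass
    [cell N] is eliminated. *)
Lemma slab_le N r : 0 <= r -> (m <= N)%N -> (0 < N)%N ->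
  (N%:R * r + m%:R <= N%:R) ->
  slab r * (1 - m%:R / N%:R) ^+ m <= (r + m%:R / N%:R) ^+ m * slab 1.
Proof.
move=> r0 mN N0 rN; have Nr0 : 0 < N%:R :> R by rewrite ltr0n.
have Nr_ge0 : 0 <= N%:R * r by rewrite mulr_ge0// ltW.
pose p := Num.truncn (N%:R * r).
have /andP[p1 p2] : p%:R <= N%:R * r < p.+1%:R by exact: truncn_itv.
have pN : (p + m <= N)%N by rewrite -(ler_nat R) natrD; lra.
have U := slab_upper N0 pN p2.
have L : 'C(N, m)%:R * cell N <= slab 1 by apply: slab_lower; rewrite ?mulr1 ?mN/=.
have E1 : (1 - m%:R / N%:R) ^+ m = ((N - m) ^ m)%N%:R / N%:R ^+ m :> R.
  rewrite natrX natrB// -expr_div_n mulrBl divff ?gt_eqF//.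
have E2 : (p + m)%:R / N%:R <= r + m%:R / N%:R :> R.
  by rewrite natrD mulrDl lerD2r ler_pdivrMr// mulrC.
apply: le_trans (_ : ((p + m)%:R / N%:R) ^+ m * slab 1 <= _); last first.
  apply: ler_wpM2r => //; apply: lerXn2r => //; rewrite nnegrE.
    by rewrite divr_ge0.
  by rewrite addr_ge0// divr_ge0.
rewrite E1 expr_div_n mulrA (mulrAC _ _ (slab 1)) ler_wpM2r ?invr_ge0 ?exprn_ge0//.
apply: le_trans (_ : slab r * (N ^_ m)%:R <= _).
  by rewrite ler_wpM2l// ler_nat ffact_geq_exp.
rewrite -bin_ffact natrM.
apply: le_trans (_ : 'C(m + p, m)%:R * cell N * ('C(N, m)%:R * m`!%:R) <= _).
  by rewrite ler_wpM2r// mulr_ge0.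
apply: le_trans (_ : ((p + m) ^_ m)%:R * slab 1 <= _).
  rewrite -bin_ffact natrM (addnC p) (_ : _ * cell N * _ =
    'C(m + p, m)%:R * m`!%:R * ('C(N, m)%:R * cell N)); last by ring.
  by rewrite ler_wpM2l.
by rewrite -natrX ler_wpM2r// ler_nat ffact_leq_exp.
Qed.

(** Here the bounds exchange roles. [slab_upper] does not reach size 1, where cubes stick out of the
    simplex; size 1 - m/N, with p = N - m, replaces it. *)
Lemma slab_ge N r : 0 <= r <= 1 -> (0 < N)%N -> m.+1%:R <= N%:R * r ->
  slab (1 - m%:R / N%:R) * (r - m.+1%:R / N%:R) ^+ m <= slab r.
Proof.
move=> /andP[r0 r1] N0 rN; have Nr0 : 0 < N%:R :> R by rewrite ltr0n.
have Nr_ge0 : 0 <= N%:R * r by rewrite mulr_ge0// ltW.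
pose p := Num.truncn (N%:R * r).
have /andP[p1 p2] : p%:R <= N%:R * r < p.+1%:R by exact: truncn_itv.
have NrN : N%:R * r <= N%:R by rewrite ler_piMr// ltW.
have mp : (m <= p)%N by rewrite -ltnS -(ltr_nat R) (lt_trans _ (le_lt_trans rN p2))// ltr_nat.
have pN : (p <= N)%N by rewrite -(ler_nat R) (le_trans p1).
have mN := leq_trans mp pN.
have U : slab (1 - m%:R / N%:R) <= 'C(N, m)%:R * cell N.
  have /slab_upper : (N - m + m <= N)%N by rewrite subnK.
  rewrite subnKC//; apply => //.
  by rewrite mulrBr mulr1 mulrC divfK ?gt_eqF// -natrB// ltr_nat.
have L : 'C(p, m)%:R * cell N <= slab r by apply: slab_lower; rewrite ?mp.
(* Truncation to [p] loses at most 1 and the bound on the falling factorial loses [m], whence the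
   [m.+1]. *)
apply: le_trans (_ : slab (1 - m%:R / N%:R) * ((p - m)%:R / N%:R) ^+ m <= _).
  apply: ler_wpM2l => //; apply: lerXn2r; rewrite ?nnegrE ?divr_ge0//.
    by rewrite subr_ge0 ler_pdivrMr// mulrC.
  rewrite natrB// ler_pdivlMr// mulrBl divfK ?gt_eqF// mulrC.
  by move: p2; rewrite -!natr1; lra.
rewrite expr_div_n mulrA ler_pdivrMr ?exprn_gt0//.
apply: le_trans (_ : slab (1 - m%:R / N%:R) * (p ^_ m)%:R <= _).
  by rewrite ler_wpM2l// -natrX ler_nat ffact_geq_exp.
rewrite -bin_ffact natrM.
apply: le_trans (_ : 'C(N, m)%:R * cell N * ('C(p, m)%:R * m`!%:R) <= _).
  by rewrite ler_wpM2r// mulr_ge0.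
apply: le_trans (_ : slab r * (N ^_ m)%:R <= _); last first.
  by rewrite ler_wpM2l// -natrX ler_nat ffact_leq_exp.
rewrite -bin_ffact natrM (_ : _ * cell N * _ =
  'C(p, m)%:R * cell N * ('C(N, m)%:R * m`!%:R)); last by ring.
by rewrite ler_wpM2r.
Qed.

(** These slabs increase to the full slab minus the matrices whose entry (i, j) is zero, a null set;
    continuity from below concludes. *)
Lemma cvg_slab1 : slab (1 - m%:R / N.+1%:R) @[N --> \oo] --> slab 1.
Proof.
pose F N := row_slab i j C (1 - m%:R / N.+1%:R).
have mF N : measurable (F N) by exact: measurable_row_slab.
pose Z : set (mx_borel R n) := row_slab i j C 1 `&` [set M | (M : 'M[R]_n) i j = 0].
have mZ0 := measurable_entry_set i j (measurable_set1 (0 : R)).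
have mZ : measurable Z by apply: measurableI => //; exact: measurable_row_slab.
have Z0 : mu Z = 0%E.
  apply/eqP; rewrite -measure_le0; rewrite -(mu_entry_eq0 mu_uniform i j).
  by apply: le_measure; rewrite ?inE// => M [].
have mUF : measurable (\bigcup_N F N) by exact: bigcupT_measurable.
have UF : row_slab i j C 1 = \bigcup_N F N `|` Z.
  apply/seteqP; split => [M [mM CM _]|M [[N _ [mM CM _]]|[]//]]; last first.
    by split => //; rewrite subrr mM.1.
  have := mM.1 i j; rewrite le_eqVlt => /predU1P[M0|M_gt0].
    by right; split=> //; split=> //; rewrite subrr M0.
  left; exists (Num.truncn (m%:R / M i j)) => //; split=> //.
  by rewrite subKr ler_pdivrMr// mulrC -ler_pdivrMr// ltW// truncnS_gt.
have nF : nondecreasing_seq F.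
  move=> N K NK; apply/subsetPset => M [mM CM]; rewrite subKr => H; split => //.
  rewrite subKr; apply: le_trans H; apply: ler_wpM2l => //.
  by rewrite lef_pV2 ?posrE// ler_nat.
have cF : (mu \o F) N @[N --> \oo] --> (slab 1)%:E.
  by rewrite -slabE UF measureU0//; exact: nondecreasing_cvg_mu.
by have /fine_cvg := cF.
Qed.

(** Limit of [slab_le] and [slab_ge] as N grows. The side condition of the former excludes r = 1,
    that of the latter r = 0, so these values are treated apart. *)
Lemma slabX r : (0 < m)%N -> 0 <= r <= 1 -> slab r = r ^+ m * slab 1.
Proof.
move=> m0 /andP[r0 r1].
have [->|r_neq1] := eqVneq r 1; first by rewrite expr1n mul1r.
have {}r1 : r < 1 by rewrite lt_neqAle r_neq1.
have cvgV (a : R) : a / N.+1%:R @[N --> \oo] --> 0.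
  by rewrite -(mulr0 a); apply: cvgM; [exact: cvg_cst|exact: cvg_harmonic].
have cvgX (u : nat -> R) (a : R) : u @ \oo --> a -> u N ^+ m @[N --> \oo] --> a ^+ m.
  by move=> ua; exact: (cvg_comp u (fun x => x ^+ m) ua (exprn_continuous (x := a))).
have large (e a : R) : 0 < e -> \forall N \near \oo, a <= N.+1%:R * e.
  move=> e0; near=> N; rewrite -ler_pdivrMr//.
  by apply: le_trans (_ : N%:R <= _); [near: N; exact: nbhs_infty_ger|rewrite ler_nat].
apply/eqP; rewrite eq_le; apply/andP; split.
  have L : slab r * (1 - m%:R / N.+1%:R) ^+ m @[N --> \oo] --> slab r * (1 - 0) ^+ m.
    by apply: cvgM; [exact: cvg_cst|apply: cvgX; apply: cvgB; [exact: cvg_cst|exact: cvgV]].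
  have U : (r + m%:R / N.+1%:R) ^+ m * slab 1 @[N --> \oo] --> (r + 0) ^+ m * slab 1.
    by apply: cvgM; [apply: cvgX; apply: cvgD; [exact: cvg_cst|exact: cvgV]|exact: cvg_cst].
  move: L U; rewrite subr0 expr1n mulr1 addr0 => L U.
  apply: (ler_cvg_to L U); near=> N.
  have rN : m%:R <= N.+1%:R * (1 - r) by near: N; apply: large; rewrite subr_gt0.
  apply: slab_le => //; last by lra.
  rewrite -(ler_nat R); apply: le_trans rN _; rewrite ler_piMr//; lra.
have [->|r_neq0] := eqVneq r 0; first by rewrite expr0n (gtn_eqF m0) mul0r.
have {}r0 : 0 < r by rewrite lt_neqAle eq_sym r_neq0.
have L : slab (1 - m%:R / N.+1%:R) * (r - m.+1%:R / N.+1%:R) ^+ m @[N --> \oo] -->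
    slab 1 * (r - 0) ^+ m.
  apply: cvgM; first exact: cvg_slab1.
  by apply: cvgX; apply: cvgB; [exact: cvg_cst|exact: cvgV].
move: L; rewrite subr0 mulrC => L.
apply: (ler_cvg_to L (cvg_cst _)); near=> N.
apply: slab_ge => //; first by rewrite (ltW r0) ltW.
by near: N; exact: large.
Unshelve. all: by end_near. Qed.

Lemma mu_entry_ge t : (0 < m)%N -> 0 <= t <= 1 ->
  mu (C `&` [set M | t <= (M : 'M[R]_n) i j]) = (((1 - t) ^+ m)%:E * mu C)%E.
Proof.
move=> m0 /andP[t0 t1].
have mt : measurable [set M : mx_borel R n | t <= (M : 'M[R]_n) i j].
  have := measurable_entry_set i j (measurable_itv `[t, +oo[).
  by congr measurable; apply/seteqP; split => M /=; rewrite in_itv/= andbT.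
have slabS r : row_slab i j C r =
    C `&` [set M : mx_borel R n | 1 - r <= (M : 'M[R]_n) i j] `&` @markov_mx R n.
  by apply/seteqP; split => M /=; [case|move=> [[]]].
have -> : mu C = (slab 1)%:E.
  rewrite -slabE slabS -(mu_setI_markov mu_uniform mC); congr (mu _).
  apply/seteqP; split => M /=; last by move=> [[]].
  by rewrite subrr => -[CM mM]; split=> //; split=> //; exact: mM.1.
rewrite -EFinM -slabX//; last by lra.
rewrite -slabE slabS subKr (mu_setI_markov mu_uniform)//.
exact: measurableI.
Qed.

End slab.

(** * Beta distributions *)

(** Closed right rays form a generating pi-system. A ray starting below 0 weighs as much as the one
    starting at 0, and a ray starting above 1 is null. *)
Lemma eq_measure_tails01 (R : realType) (m1 m2 : {measure set (measurableTypeR R) -> \bar R}) :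
  (m1 setT < +oo)%E ->
  m1 (~` `[0, 1]%classic) = 0%E -> m2 (~` `[0, 1]%classic) = 0%E ->
  (forall t : R, 0 <= t <= 1 -> m1 `[t, +oo[%classic = m2 `[t, +oo[%classic) ->
  forall A, measurable A -> m1 A = m2 A.
Proof.
move=> m1oo m10 m20 m12 A mA.
pose G := @RGenCInfty.G R.
have mC01 : measurable (~` `[0, 1]%classic : set R) by apply: measurableC.
have null (mu : {measure set (measurableTypeR R) -> \bar R}) (B : set R) : measurable B ->
    mu (~` `[0, 1]%classic) = 0%E -> B `<=` ~` `[0, 1]%classic -> mu B = 0%E.
  move=> mB mu0 B01; apply/eqP; rewrite -measure_le0 -mu0.
  by apply: le_measure; rewrite ?inE.
have neg (mu : {measure set (measurableTypeR R) -> \bar R}) t : t < 0 ->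
    mu (~` `[0, 1]%classic) = 0%E -> mu `[t, +oo[%classic = mu `[0, +oo[%classic.
  move=> t0 mu0.
  have -> : `[t, +oo[%classic = `[0, +oo[%classic `|` `[t, 0[%classic :> set R.
    by apply/seteqP; split => x /=; rewrite !in_itv/= ?andbT; lra.
  apply: measureU0 => //; apply: null => // x /=; rewrite !in_itv/=; lra.
apply: (@measure_unique _ R (measurableTypeR R) G (fun k => `[- k%:R, +oo[%classic)) => //.
- exact: RGenCInfty.measurableE.
- move=> _ _ [x ->] [y ->]; exists (Num.max x y).
  by apply/seteqP; split => z /=; rewrite !in_itv/= !andbT ge_max => /andP.
- by move=> k; exists (- k%:R).
- rewrite -subTset => x _; exists (Num.truncn `|x|).+1 => //=.
  rewrite in_itv/= andbT lerNl; apply: le_trans (ltW (truncnS_gt _)).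
  by rewrite -normrN ler_norm.
- move=> _ [t ->]; have [t0|t0] := ltP t 0.
    have := m12 0; rewrite lexx ler01 => /(_ erefl).
    by rewrite -(neg m1 t)// -(neg m2 t).
  have [t1|t1] := leP t 1; first by apply: m12; rewrite t0.
  have t01 : `[t, +oo[%classic `<=` ~` `[0, 1] by move=> x /=; rewrite !in_itv/= andbT; lra.
  by transitivity (0%E : \bar R); [|symmetry]; apply: null.
- by move=> k; apply: le_lt_trans m1oo; apply: le_measure; rewrite ?inE.
Qed.

Section beta.
Context (R : realType).
Local Notation leb := (@lebesgue_measure R).

Lemma derivable_oo_LRcontinuous_onemXn k (c a b : R) :
  derivable_oo_LRcontinuous (fun y : R => y.~ ^+ k * c) a b.
Proof.
have cts : continuous (fun y : R => y.~ ^+ k * c).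
  by move=> x; apply: cvgM; [exact: continuous_onemXn|exact: cvg_cst].
split=> [y _||].
- by apply: derivableM => //=; exact: onemXn_derivable.
- exact/cvg_at_right_filter/cts.
- exact/cvg_at_left_filter/cts.
Qed.

Lemma integral_onemXn k (t : R) : t <= 1 ->
  (\int[leb]_(x in `[t, 1%R]) (x.~ ^+ k)%:E = ((1 - t) ^+ k.+1 / k.+1%:R)%:E)%E.
Proof.
rewrite le_eqVlt => /predU1P[->|t1].
  by rewrite set_itv1 integral_set1 subrr expr0n mul0r.
rewrite (@continuous_FTC2 _ _ (fun x => x.~ ^+ k.+1 / - k.+1%:R))//=.
- by rewrite onem1 expr0n/= mul0r add0e invrN mulrN opprK /onem.
- by apply: continuous_in_subspaceT => x _; exact: continuous_onemXn.
- exact: derivable_oo_LRcontinuous_onemXn.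
- move=> x _; rewrite derive1Mr//; last exact: onemXn_derivable.
  by rewrite derive_onemXn mulrAC divff// ?mul1r// oppr_eq0.
Qed.

Lemma beta_prob_tail k (t : R) : 0 <= t <= 1 ->
  beta_prob 1 k.+1 `[t, +oo[%classic = ((1 - t) ^+ k.+1)%:E.
Proof.
move=> /andP[t0 t1]; rewrite /beta_prob/= /mscale/= integral_XMonemX_restrict.
have -> : `[t, +oo[%classic `&` `[0, 1]%classic = `[t, 1]%classic.
  by apply/seteqP; split => x /=; rewrite !in_itv/= ?andbT; lra.
under eq_integral do rewrite XMonemX0n.
by rewrite integral_onemXn// beta_fun1Sn invrK -EFinM mulrC divfK.
Qed.

Lemma beta_prob_setC01 a b : beta_prob a b (~` `[0, 1]%classic) = 0%E :> \bar R.
Proof.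
rewrite /beta_prob/= /mscale/= integral_XMonemX_restrict setICl.
by rewrite integral_set0 mule0.
Qed.

(** The moment is B(3, k+1)/B(1, k+1), that is (k+1) * 2 k!/(k+3)!. *)
Lemma beta_prob_moment2 k :
  (\int[beta_prob 1 k.+1]_(x in `[0%R, 1%R]) (x ^+ 2)%:E =
   (2 / (k.+2%:R * k.+3%:R))%:E :> \bar R)%E.
Proof.
have XE (x : R) : x ^+ 2 = XMonemX 2 0 x by rewrite XMonemXn0.
under eq_integral do rewrite XE.
have mX : measurable_fun (`[0, 1]%classic : set (measurableTypeR R))
    (fun x : measurableTypeR R => (XMonemX 2 0 x)%:E).
  by apply: measurableT_comp => //; exact: measurable_XMonemX.
have /integrableP[_ intX] := beta_prob_integrable (R := R) 1 k.+1 2 0.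
rewrite integral_beta_prob//.
transitivity (\int[leb]_(x in `[0%R, 1%R])
    ((XMonemX 2 k x)%:E * (beta_fun 1 k.+1)^-1%:E))%E.
  apply: eq_integral => x x01; rewrite -!EFinM /beta_pdf patchE x01 mulrA; congr (_ / _)%:E.
  by rewrite XMonemXM add0n addn0.
rewrite ge0_integralZr//=; last 3 first.
- by apply: measurableT_comp => //; exact: measurable_XMonemX.
- by move=> x x01; rewrite lee_fin XMonemX_ge0.
- by rewrite lee_fin invr_ge0 beta_fun_ge0.
have -> : (\int[leb]_(x in `[0%R, 1%R]) (XMonemX 2 k x)%:E = (beta_fun 3 k.+1)%:E)%E.
  by rewrite EFin_beta_fun integral_XMonemX_restrict setTI.
rewrite -EFinM beta_fun1Sn invrK beta_fun_fact add2n !factS natrM; congr EFin.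
have k0 : k`!%:R != 0 :> R by rewrite pnatr_eq0 -lt0n fact_gt0.
rewrite !natrM; field.
by rewrite k0 -!natrD nat1r !pnatr_eq0.
Qed.

End beta.

(** * Law and independence of the entries *)

Section law.
Context (R : realType) (n : nat) (mu : probability (mx_borel R n) R).
Hypothesis mu_uniform : forall A : set (mx_borel R n), measurable A ->
  mu A = uniform_markov A.
Hypothesis n_ge2 : (2 <= n)%N.

Lemma markov_le1 (M : 'M[R]_n) i j : markov_mx M -> 0 <= M i j <= 1.
Proof.
move=> [M0 M1]; rewrite M0 -(M1 i) (bigD1 j)//= lerDl.
by apply: sumr_ge0 => l _; exact: M0.
Qed.

Lemma mu_nmarkov (A : set (mx_borel R n)) : measurable A ->
  A `<=` ~` @markov_mx R n -> mu A = 0%E.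
Proof.
move=> mA AM; rewrite -(mu_setI_markov mu_uniform mA).
rewrite (_ : A `&` _ = set0) ?measure0//.
by apply/seteqP; split => // M [/AM].
Qed.

Lemma mu_entry_setC01 i j : mu (mx_coord i j @^-1` (~` `[0, 1]%classic)) = 0%E.
Proof.
apply: mu_nmarkov => [|M /= M01 /markov_le1 H].
  by apply: measurable_entry_set; exact: measurableC.
by apply: M01; rewrite /= in_itv/=; exact: H.
Qed.

(** As functions of [B] both sides are finite measures carried by [0, 1], and [mu_entry_ge] gives
    them the same tails. *)
Lemma mu_entry_setI i j (C : set (mx_borel R n)) (B : set R) : measurable C ->
  (forall M M' : 'M[R]_n, (forall a b, a != i -> M a b = M' a b) -> C M -> C M') ->
  measurable B ->
  mu (mx_coord i j @^-1` B `&` C) = (mu C * beta_prob 1 n.-1 B)%E.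
Proof.
move=> mC C_row mB.
have r0 : 0 <= fine (mu C) by rewrite fine_ge0.
have muC : (fine (mu C))%:E = mu C by rewrite fineK// fin_num_measure.
pose m1' : {measure set (measurableTypeR R) -> \bar R} :=
  pushforward (mrestr mu mC) (mx_coord i j : _ -> measurableTypeR R).
pose m1 := m1' (@measurable_mx_coord R n i j).
pose m2 : {measure set (measurableTypeR R) -> \bar R} :=
  mscale (NngNum r0) (beta_prob (R := R) 1 n.-1).
suff : m1 B = m2 B by rewrite /m1 /m1' /m2 /= /pushforward /mrestr /mscale/= muC.
apply: (@eq_measure_tails01 R m1 m2) mB.
- rewrite /m1 /m1'/= /pushforward /mrestr preimage_setT setTI -muC; exact: ltry.
- apply/eqP; rewrite -measure_le0 -(mu_entry_setC01 i j) /m1 /m1' /= /pushforward /mrestr.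
  by apply: le_measure; rewrite ?inE => //; [apply: measurableI => //|];
    apply: measurable_entry_set; exact: measurableC.
- by rewrite /m2 /= /mscale/= beta_prob_setC01 mule0.
- move=> t t01; rewrite /m1 /m1' /m2 /= /pushforward /mrestr /mscale/= muC.
  have tail : beta_prob 1 n.-1 `[t, +oo[%classic = ((1 - t) ^+ n.-1)%:E :> \bar R.
    by case: n n_ge2 => [|[|k]]// _; exact: beta_prob_tail.
  have n0 : (0 < n.-1)%N by case: n n_ge2 => [|[]].
  have := mu_entry_ge mu_uniform j mC C_row n0 t01.
  rewrite tail muleC => <-; congr (mu _); rewrite setIC; congr (_ `&` _).
  by apply/seteqP; split => M /=; rewrite in_itv/= andbT.
Qed.

Lemma mu_entry i j (B : set R) : measurable B ->
  mu (mx_coord i j @^-1` B) = beta_prob 1 n.-1 B.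
Proof.
move=> mB; have := @mu_entry_setI i j setT B measurableT (fun _ _ _ => id) mB.
by rewrite setIT probability_setT mul1e.
Qed.

(** The event on row [i'] takes the place of [C] in [mu_entry_setI]. *)
Lemma mu_entries_indep i i' j j' (A B : set R) : i != i' ->
  measurable A -> measurable B ->
  mu (mx_coord i j @^-1` A `&` mx_coord i' j' @^-1` B) =
  (mu (mx_coord i j @^-1` A) * mu (mx_coord i' j' @^-1` B))%E.
Proof.
move=> ii' mA mB; rewrite mu_entry_setI//; last 2 first.
- exact: measurable_entry_set.
- by move=> M M' MM' /=; rewrite /mx_coord MM'// eq_sym.
by rewrite (mu_entry i j mA) muleC.
Qed.

(** Since 2/3 exceeds 1/2, two distinct entries of a row cannot both lie in [A], though each does
    with positive probability p. If j = j', the product formula would give p = p^2 with 0 < p <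
    1. *)
Lemma mu_entries_dep i j j' (A := `[2 / 3, +oo[%classic : set R) :
  mu (mx_coord i j @^-1` A `&` mx_coord i j' @^-1` A) <>
  (mu (mx_coord i j @^-1` A) * mu (mx_coord i j' @^-1` A))%E.
Proof.
have mA : measurable A by exact: measurable_itv.
have muA l : mu (mx_coord i l @^-1` A) = ((3^-1) ^+ n.-1)%:E.
  rewrite mu_entry// (_ : n.-1 = n.-2.+1); last by case: n n_ge2 => [|[|k]].
  by rewrite beta_prob_tail; [congr (_ ^+ _)%:E; lra|lra].
have p0 : 0 < 3^-1 ^+ n.-1 :> R by rewrite exprn_gt0.
rewrite !muA; have [->|jj'] := eqVneq j j'.
  rewrite setIid muA -EFinM => -[] /esym/eqP.
  rewrite -subr_eq0 -{3}(mulr1 (3^-1 ^+ n.-1)) -mulrBr mulf_eq0 gt_eqF//= subr_eq0 lt_eqF//.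
  by rewrite exprn_ilt1 ?invr_ge0 ?invf_lt1 ?ltr1n//; case: n n_ge2 => [|[]].
rewrite (mu_nmarkov _ _); first by rewrite -EFinM => -[] /esym/eqP; rewrite mulf_eq0 gt_eqF.
  by apply: measurableI; exact: measurable_entry_set.
move=> M [/= + +] mM; rewrite /A/= !in_itv/= !andbT => Mj Mj'.
have := mM.2 i; rewrite (bigD1 j)//= (bigD1 j')/= 1?eq_sym//.
have : 0 <= \sum_(l | (l != j) && (l != j')) (M : 'M[R]_n) i l.
  by apply: sumr_ge0 => l _; exact: mM.1.
move: Mj Mj'; rewrite /mx_coord; lra.
Qed.

End law.

(** * Second moments *)

Section moments.
Context (R : realType) (n : nat) (mu : probability (mx_borel R n) R).
Hypothesis mu_uniform : forall A : set (mx_borel R n), measurable A ->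
  mu A = uniform_markov A.
Hypothesis n_ge2 : (2 <= n)%N.

Local Notation markov := (@markov_mx R n : set (mx_borel R n)).
(** Integrating over the polytope makes the row sums and the bounds on entries available at every
    point. *)
Local Notation mean g := (\int[mu]_(M in markov) g M).

Let mmarkov := @measurable_markov R n.

Let mu_setC_markov : mu (~` markov) = 0%E.
Proof. by apply: (mu_nmarkov mu_uniform) => //; exact: measurableC. Qed.

Lemma markov_bounded_integrable (g : mx_borel R n -> R) :
  measurable_fun setT g -> (forall M, markov_mx M -> `|g M| <= 1) ->
  mu.-integrable markov (EFin \o g).
Proof.
move=> mg g1; apply: measurable_bounded_integrable => //.
- by rewrite -ge0_fin_numE// fin_num_measure.
- exact: measurable_funTS.
- by exists 1; split=> // x x1 M mM; apply: le_trans (ltW x1); exact: g1.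
Qed.

Lemma mean_permute_rows (s : 'I_n -> {perm 'I_n}) (g : mx_borel R n -> R) :
  measurable_fun setT g -> (forall M, markov_mx M -> `|g M| <= 1) ->
  mean (fun M => g (permute_rows s M)) = mean g.
Proof.
move=> mg g1; rewrite /Rintegral; congr fine.
pose f : mx_borel R n -> mx_borel R n := permute_rows s.
have fM : f @^-1` markov = markov.
  by apply/seteqP; split => M mM; apply/(markov_permute_rows s).
have intf : mu.-integrable (f @^-1` markov) ((EFin \o g) \o f).
  rewrite fM; apply: (@markov_bounded_integrable (g \o f)) => [|M mM].
    by apply: measurableT_comp => //; exact: measurable_permute_rows.
  by apply: g1; apply/markov_permute_rows.
have := integral_pushforward (measurable_permute_rows s) _ intf mmarkov.
rewrite fM => <-; last exact/measurable_EFinP.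
apply: eq_measure_integral => [|mf A mA]; first exact: measurable_permute_rows.
move=> _. exact: (mu_permute_rows mu_uniform s mA).
Qed.

Lemma mean_sum (I : Type) (r : seq I) (P : pred I) (g : I -> mx_borel R n -> R) :
  (forall k, measurable_fun setT (g k)) ->
  (forall k M, markov_mx M -> `|g k M| <= 1) ->
  mean (fun M => \sum_(k <- r | P k) g k M) = \sum_(k <- r | P k) mean (g k).
Proof.
move=> mg g1; have ig k : mu.-integrable markov (EFin \o g k).
  by apply: markov_bounded_integrable; [exact: mg|exact: g1].
have gE k : (mean (g k))%:E = (\int[mu]_(M in markov) (g k M)%:E)%E.
  by rewrite fineK//; apply: integrable_fin_num => //; exact: ig.
apply: EFin_inj; rewrite -sumEFin (eq_bigr _ (fun k _ => gE k)) -integral_sum//.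
rewrite fineK; first by apply: eq_integral => M _; rewrite sumEFin.
under eq_integral do rewrite -sumEFin.
by apply: integrable_fin_num => //; apply: (integrable_sum mmarkov) => k _; exact: ig.
Qed.

Lemma markov_entry_norm_le1 M (i j : 'I_n) : markov_mx M -> `|mx_coord i j M : R| <= 1.
Proof. by move=> /(markov_le1 i j)/andP[M0 M1]; rewrite ger0_norm. Qed.

Lemma markov_entryM_norm_le1 M (i j i' j' : 'I_n) : markov_mx M ->
  `|mx_coord i j M * mx_coord i' j' M : R| <= 1.
Proof. by move=> mM; rewrite normrM mulr_ile1// markov_entry_norm_le1. Qed.

Lemma measurable_entryM (i j i' j' : 'I_n) :
  measurable_fun setT (fun M : mx_borel R n => mx_coord i j M * mx_coord i' j' M).
Proof. by apply: measurable_funM; exact: measurable_mx_coord. Qed.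

Let n_gt0 : 0 < n%:R :> R. Proof. by rewrite ltr0n; case: n n_ge2. Qed.

(** Transpositions show that the n entries of a row have the same mean, and these means add up to
    1. *)
Lemma mean_entry i j : mean (mx_coord i j) = n%:R^-1.
Proof.
have mc := @measurable_mx_coord R n.
have same l : mean (mx_coord i l) = mean (mx_coord i j).
  rewrite -(@mean_permute_rows (fun=> tperm l j) (mx_coord i l))//.
    by apply: eq_Rintegral => M _; rewrite /mx_coord mxE tpermL.
  by move=> M; exact: markov_entry_norm_le1.
have : \sum_l mean (mx_coord i l) = 1.
  rewrite -(@mean_sum _ _ _ (mx_coord i))//; last by move=> k M; exact: markov_entry_norm_le1.
  rewrite (@eq_Rintegral _ _ _ mu _ (cst 1)); last by move=> M /set_mem[_ ->].
  rewrite Rintegral_cst// mul1r; exact: (congr1 fine (mu_markov mu_uniform)).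
under eq_bigr do rewrite same.
rewrite sumr_const card_ord => H.
by apply: (mulfI (lt0r_neq0 n_gt0)); rewrite mulr_natl H divff// gt_eqF.
Qed.

(** Row [i'] sums to 1, so the sum collapses to the mean of a single entry. *)
Lemma sum_mean_entryM i j i' : \sum_l mean (fun M => mx_coord i j M * mx_coord i' l M) = n%:R^-1.
Proof.
rewrite -(@mean_sum _ _ _ (fun l M => mx_coord i j M * mx_coord i' l M)).
- rewrite -(mean_entry i j); apply: eq_Rintegral => M /set_mem[_ M1].
  by rewrite -mulr_sumr; have /= := M1 i'; rewrite /mx_coord => ->; rewrite mulr1.
- by move=> k; exact: measurable_entryM.
- by move=> k M; exact: markov_entryM_norm_le1.
Qed.

Lemma mean_entryM_row (s : 'I_n -> {perm 'I_n}) i j i' j' :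
  mean (fun M => mx_coord i (s i j) M * mx_coord i' (s i' j') M) =
  mean (fun M => mx_coord i j M * mx_coord i' j' M).
Proof.
rewrite -(@mean_permute_rows s (fun M => mx_coord i j M * mx_coord i' j' M)).
- by apply: eq_Rintegral => M _; rewrite /mx_coord !mxE.
- exact: measurable_entryM.
- by move=> M; exact: markov_entryM_norm_le1.
Qed.

Lemma mean_entryM_neq i j i' j' : i != i' ->
  mean (fun M => mx_coord i j M * mx_coord i' j' M) = (n%:R^-1) ^+ 2.
Proof.
move=> ii'; have := sum_mean_entryM i j i'.
rewrite (eq_bigr (fun=> mean (fun M => mx_coord i j M * mx_coord i' j' M))) => [|l _].
  rewrite sumr_const card_ord => H.
  by apply: (mulfI (lt0r_neq0 n_gt0)); rewrite mulr_natl H expr2 mulrA divff ?mul1r// gt_eqF.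
(* Only row [i'] is permuted, so the factor from row [i] is unchanged and all summands agree. *)
rewrite -(mean_entryM_row (fun a => if a == i' then tperm j' l else 1%g) i j i' j').
by rewrite (negbTE ii') eqxx perm1 tpermL.
Qed.

Lemma mean_entryX i j :
  mean (fun M => mx_coord i j M * mx_coord i j M) = 2 / (n%:R * n.+1%:R).
Proof.
have [k nk] : exists k, n = k.+2 by case: n n_ge2 => [|[|k]] // _; exists k.
rewrite /Rintegral.
have mX : measurable_fun setT (fun M : mx_borel R n => (mx_coord i j M ^+ 2)%:E).
  by apply/measurable_EFinP; apply: measurable_funX; exact: measurable_mx_coord.
have X0 (M : mx_borel R n) : (0 <= (mx_coord i j M ^+ 2)%:E)%E by rewrite lee_fin sqr_ge0.
(* The polytope and this preimage both have full mass; the preimage is the domain required by the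
   change of variables to [0, 1]. *)
transitivity (fine (\int[mu]_(M in mx_coord i j @^-1` `[0%R, 1%R]%classic)
    (mx_coord i j M ^+ 2)%:E)).
  congr fine; under eq_integral do rewrite -expr2.
  have m01 : measurable (mx_coord i j @^-1` `[0%R, 1%R]%classic : set (mx_borel R n)).
    exact: measurable_entry_set.
  rewrite -[in LHS](setCK markov) -setTD -(ge0_negligible_integral _ _ _ _ mu_setC_markov)//;
    last exact: measurableC.
  rewrite -[in RHS](setCK (_ @^-1` _)) -setTD.
  rewrite -(ge0_negligible_integral _ _ _ _ (mu_entry_setC01 mu_uniform i j))//.
  by apply: measurable_entry_set; exact: measurableC.
pose X : mx_borel R n -> measurableTypeR R := mx_coord i j.
have mXX : measurable_fun setT X by exact: measurable_mx_coord.
transitivity (fine (\int[beta_prob (R := R) 1 n.-1]_(x in `[0%R, 1%R]) (x ^+ 2)%:E)); last first.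
  by rewrite nk beta_prob_moment2.
congr fine.
have := @ge0_integral_pushforward _ _ _ _ R X mXX mu (`[0%R, 1%R]%classic)
  (fun x : measurableTypeR R => ((x : R) ^+ 2)%:E).
move=> <-//; last 2 first.
- by apply/measurable_EFinP; exact: measurable_funX.
- by move=> x _; rewrite lee_fin sqr_ge0.
by apply: eq_measure_integral => A mA _; exact: (mu_entry mu_uniform n_ge2).
Qed.

(** In [sum_mean_entryM] with i' = i, the n - 1 off-diagonal terms are equal and share what the
    second moment leaves of 1/n. *)
Lemma mean_entryM_eq i j j' : j != j' ->
  mean (fun M => mx_coord i j M * mx_coord i j' M) = 1 / (n%:R * n.+1%:R).
Proof.
move=> jj'; have := sum_mean_entryM i j i.
rewrite (bigD1 j)//= mean_entryX.
rewrite (eq_bigr (fun=> mean (fun M => mx_coord i j M * mx_coord i j' M))) => [|l lj].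
  rewrite sumr_const cardC1 card_ord -[X in _ + X]mulr_natl.
  have n1 : n.-1%:R = n%:R - 1 :> R by rewrite -subn1 natrB// ltnW.
  have nn1 : n%:R - 1 != 0 :> R by rewrite -n1 pnatr_eq0; case: n n_ge2 => [|[]].
  have n2 : n.+1%:R = n%:R + 1 :> R by rewrite natr1.
  rewrite n1 n2 => H; apply: (mulfI nn1).
  rewrite -[LHS](addKr (2 / (n%:R * (n%:R + 1)))) H; field.
  by rewrite -n2 pnatr_eq0 /= (gt_eqF n_gt0).
(* This transposition fixes [j], which differs from both [j'] and [l]. *)
rewrite -(mean_entryM_row (fun=> tperm j' l) i j i j').
by rewrite tpermL tpermD// eq_sym.
Qed.

End moments.

(** * Transfer to a random matrix with the uniform law *)

Section random_markov.
Context d (Omega : measurableType d) (R : realType) (P : probability Omega R).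
Context (n : nat) (n_ge2 : (2 <= n)%N) (M : {RV P >-> mx_borel R n}).
Hypothesis hM : forall A : set (mx_borel R n), measurable A ->
  distribution P M A = uniform_markov A.

Let mu : probability (mx_borel R n) R := distribution P M.
Local Notation markov := (@markov_mx R n : set (mx_borel R n)).

Let mmarkov : measurable markov := @measurable_markov R n.
Let mCmarkov : measurable (~` markov) := measurableC mmarkov.

Let mu_setC_markov : mu (~` markov) = 0%E.
Proof. by apply: (mu_nmarkov hM) => //; exact: measurableC. Qed.

(** The expectation is first written as an integral against the law of [M], then the null complement
    of the polytope is dropped. *)
Lemma integrable_markov_comp (g : mx_borel R n -> R) :
  measurable_fun setT g -> (forall M, markov_mx M -> `|g M| <= 1) ->
  P.-integrable setT (EFin \o (g \o M)) /\
  (\int[P]_w (g (M w))%:E = (\int[mu]_(N in markov) g N)%:E)%E.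
Proof.
move=> mg g1; have ig := markov_bounded_integrable mu mg g1.
have mEg : measurable_fun setT (EFin \o g) by exact/measurable_EFinP.
have ig' : mu.-integrable setT (EFin \o g).
  apply/(negligible_integrable _ _ _ mu_setC_markov) => //.
  by rewrite setTD setCK.
have iP : P.-integrable setT (EFin \o (g \o M)).
  apply/integrableP; split.
    by apply/measurable_EFinP; apply: measurableT_comp.
  have /integrableP[_] := ig'.
  rewrite (@ge0_integral_distribution _ _ _ _ _ P M (fun N => `|(g N)%:E|%E))//.
  by apply: measurableT_comp.
split => //.
have -> : (\int[P]_w (g (M w))%:E = \int[mu]_N (g N)%:E)%E.
  by rewrite (integral_distribution mEg).
rewrite (negligible_integral _ _ ig' mu_setC_markov)// setTD setCK.
by rewrite fineK//; apply: integrable_fin_num.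
Qed.

Lemma covariance_entries i i' j j' :
  covariance P (entry M i j) (entry M i' j') =
  (\int[mu]_(N in markov) (mx_coord i j N * mx_coord i' j' N) - n%:R^-1 ^+ 2)%:E.
Proof.
have E1 k l := integrable_markov_comp (@measurable_mx_coord R n k l)
  (fun N => @markov_entry_norm_le1 R n N k l).
have [iXY EXY] := integrable_markov_comp (@measurable_entryM R n i j i' j')
  (fun N => @markov_entryM_norm_le1 R n N i j i' j').
have [iX EX] := E1 i j. have [iY EY] := E1 i' j'.
rewrite covarianceE; [|exact/Lfun1_integrable..].
rewrite !unlock EX EY (mean_entry hM n_ge2) (mean_entry hM n_ge2) -EFinM -expr2 EFinB.
by rewrite -EXY.
Qed.

End random_markov.

Theorem corollary1p2 (d : measure_display) (Omega : measurableType d)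
    (R : realType) (P : probability Omega R) (n : nat) (hn : (2 <= n)%N)
    (M : {RV P >-> mx_borel R n})
    (hM : forall A : set (mx_borel R n), measurable A ->
      distribution P M A = uniform_markov A) :
  [/\ forall (i j : 'I_n) (B : set R), measurable B ->
        distribution P (entry M i j) B = beta_prob 1 n.-1 B,
      forall i i' j j' : 'I_n,
        covariance P (entry M i j) (entry M i' j') =
          (if i != i' then 0
           else if j == j' then (n%:R - 1) / (n%:R ^+ 2 * (n%:R + 1))
           else - (1 / (n%:R ^+ 2 * (n%:R + 1))))%:E
    & forall i i' j j' : 'I_n,
        independent_RV (entry M i j) (entry M i' j') <-> i <> i'].
Proof.
split=> [i j B mB|i i' j j'|i i' j j'].
- exact: (mu_entry hM hn).
- rewrite covariance_entries//; congr EFin.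
  have n0 : n%:R != 0 :> R by rewrite pnatr_eq0 -lt0n ltnW.
  have n2 : n.+1%:R = n%:R + 1 :> R by rewrite natr1.
  have n1 : n%:R + 1 != 0 :> R by rewrite -n2 pnatr_eq0.
  have [<-|ii'] /= := eqVneq i i'; last by rewrite (mean_entryM_neq hM hn)// subrr.
  have [<-|jj'] /= := eqVneq j j'.
    by rewrite (mean_entryX hM hn) n2; field; rewrite n1 n0.
  by rewrite (mean_entryM_eq hM hn)// n2; field; rewrite n1 n0.
- split=> [ind ii'|/eqP ii' A B mA mB]; last exact: (mu_entries_indep hM hn).
  subst i'; apply: (mu_entries_dep hM hn (i := i) (j := j) (j' := j')).
  by apply: ind; exact: measurable_itv.
Qed.
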